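(* Fix $\gamma>0$, $s\ge 0$, $\rho>0$, and positive integers $\ell_{\max}$, $M$ and $n_p$ with $1\le n_p<n_c$. Let $\{\mathbf X_j\}_{j=1}^\infty$ be a random process with $\mathbf X_j=[\mathbf X_{j,1},\dots,\mathbf X_{j,L}]$, where the $\mathbf X_{j,k}\in\mathcal X$ ($j\ge1$, $1\le k\le L$) are i.i.d. of the form $\mathbf X_{j,k}=[\mathbf x^{(p)},\mathbf X^{(d)}_{j,k}]$ with $\mathbf x^{(p)}$ a fixed pilot vector satisfying $\|\mathbf x^{(p)}\|^2=n_p\rho$ and $\mathbf X^{(d)}_{j,k}\sim P_{\mathbf X^{(d)}}$. Let $\{\overline{\mathbf X}_j\}_{j=1}^\infty$ be an independent copy of $\{\mathbf X_j\}$. Let $\mathbf Y^v$ denote the channel outputs in rounds $1,\dots,v$ produced by the channel described in the context with input $\mathbf X^v=[\mathbf X_1,\dots,\mathbf X_v]$. Define the stopping times $$\tau=\inf\{v\ge1:\ \imath_s^v(\mathbf X^v,\mathbf Y^v)\ge\gamma\},\qquad \bar\tau=\inf\{v\ge1:\ \imath_s^v(\overline{\mathbf X}^v,\mathbf Y^v)\ge\gamma\}$$ (with $\inf\emptyset=\infty$). Then there exists an $(\ell,M,\epsilon,\rho,\ell_{\max})$-VLSF code with $$\ell\le \mathbb E[\min\{\ell_{\max},\tau\}],\qquad \epsilon\le (M-1)\,\mathbb P[\bar\tau\le\min\{\ell_{\max},\tau\}]+\mathbb P[\tau>\ell_{\max}].$$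
   Context: Channel model: fix positive integers $n_c$ (symbols per coherence block) and $L$ (blocks per round), and $\rho>0$. Let $\mathcal X=\{\mathbf x\in\mathbb C^{n_c}:\|\mathbf x\|^2=n_c\rho\}$. In each transmission round $j=1,2,\dots$ the input is $\mathbf X_j=[\mathbf X_{j,1},\dots,\mathbf X_{j,L}]$ with $\mathbf X_{j,k}\in\mathcal X$, and the output is $\mathbf Y_j=[\mathbf Y_{j,1},\dots,\mathbf Y_{j,L}]$ with $\mathbf Y_{j,k}=H_{j,k}\mathbf X_{j,k}+\mathbf W_{j,k}\in\mathbb C^{n_c}$, where $H_{j,k}\sim\mathcal{CN}(0,1)$ and $\mathbf W_{j,k}\sim\mathcal{CN}(\mathbf 0,\mathbf I_{n_c})$ are all mutually independent and independent over $j,k$ and of the inputs; the channel is memoryless: $P_{\mathbf Y_j\mid \mathbf Y_1,\dots,\mathbf Y_{j-1},\mathbf X_1,\dots,\mathbf X_j}=P_{\mathbf Y_j\mid\mathbf X_j}=\prod_{k=1}^L P_{\mathbf Y_{j,k}\mid\mathbf X_{j,k}}$. Neither side knows the fading realizations. Pilot-assisted transmission: $n_d=n_c-n_p$; each $\mathbf x_{j,k}=[\mathbf x^{(p)},\mathbf x^{(d)}_{j,k}]$ with pilot $\mathbf x^{(p)}\in\mathbb C^{n_p}$, $\|\mathbf x^{(p)}\|^2=n_p\rho$, and data $\mathbf x^{(d)}_{j,k}\in\mathbb C^{n_d}$. $P_{\mathbf X^{(d)}}$ is a distribution on $\mathbb C^{n_d}$ such that $[\mathbf x^{(p)},\mathbf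 X^{(d)}]\in\mathcal X$ almost surely. Correspondingly $\mathbf y_{j,k}=[\mathbf y^{(p)}_{j,k},\mathbf y^{(d)}_{j,k}]$. The channel estimate is $\hat h_{j,k}=\frac{1}{n_p\rho}(\mathbf x^{(p)})^H\mathbf y^{(p)}_{j,k}$. Scaled nearest-neighbor metric: $q(\mathbf x_{j,k},\mathbf y_{j,k})=\prod_{i=1}^{n_d}\exp(-|y^{(d)}_{j,k,i}-\hat h_{j,k}x^{(d)}_{j,k,i}|^2)$. Generalized information density: $\imath_s(\mathbf x_{j,k},\mathbf y_{j,k})=\log\frac{q(\mathbf x_{j,k},\mathbf y_{j,k})^s}{\mathbb E_{\overline{\mathbf X}}[q(\overline{\mathbf X},\mathbf y_{j,k})^s]}$ where $\overline{\mathbf X}=[\mathbf x^{(p)},\overline{\mathbf X}^{(d)}]$, $\overline{\mathbf X}^{(d)}\sim P_{\mathbf X^{(d)}}$; accumulated: $\imath_s^v(\mathbf x^v,\mathbf y^v)=\sum_{j=1}^v\sum_{k=1}^L\imath_s(\mathbf x_{j,k},\mathbf y_{j,k})$. VLSF code: an $(\ell,M,\epsilon,\rho,\ell_{\max})$-VLSF code ($\ell\ge1$; $M,\ell_{\max}$ positive integers; $0<\epsilon<1$) consists of (1) a common random variable $U$ on a set of cardinality at most 2 known to transmitter and receiver; (2) an encoder $f:\mathcal U\times\{1,\dots,M\}\to\mathcal X^{L\ell_{\max}}$ mapping a message $J$ uniform on $\{1,\dots,M\}$ to a codeword $\mathbf c(m)=[\mathbf c_1(m),\dots,\mathbf c_{\ell_{\max}}(m)]$,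 $\mathbf c_j(m)\in\mathcal X^L$ (sent in round $j$); (3) decoders $g_v:\mathcal U\times\mathbb C^{n_cLv}\to\{1,\dots,M\}$, $1\le v\le\ell_{\max}$, and a stopping time $\tau^*$ adapted to the filtration $\{\sigma(U,\mathbf Y_1,\dots,\mathbf Y_v)\}_{v=1}^{\ell_{\max}}$ with $\mathbb E[\tau^*]\le\ell$ and $\mathbb P[g_{\tau^*}(U,\mathbf Y_1,\dots,\mathbf Y_{\tau^*})\ne J]\le\epsilon$. *)

(* Defs.v *)
From HB Require Import structures.
From mathcomp Require Import all_boot all_order all_algebra.
From mathcomp Require Import all_classical all_reals all_analysis.
From mathcomp Require Import complex.

Set Implicit Arguments.
Unset Strict Implicit.
Unset Printing Implicit Defensive.

Import Order.TTheory GRing.Theory Num.Theory.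
Local Open Scope ring_scope.
Local Open Scope classical_set_scope.

(* The block length is n_c = np + nd (pilot part first, data part second).   *)
(* Rounds j are 0-based (round j+1 of the paper).                            *)

Section Basic.
Context {R : realType}.

Definition creal (a : R) : R[i] := Complex a 0.

Definition cnorm2 (z : R[i]) : R := complex.Re z ^+ 2 + complex.Im z ^+ 2.

Definition vnorm2 (n : nat) (x : 'I_n -> R[i]) : R := \sum_(i < n) cnorm2 (x i).

Definition catv (np nd : nat) (xp : 'I_np -> R[i]) (xd : 'I_nd -> R[i])
  : 'I_(np + nd) -> R[i] :=
  fun i => match fintype.split i with inl a => xp a | inr b => xd b end.

Definition chan_est (np nd : nat) (rho : R) (xp : 'I_np -> R[i])
  (y : 'I_(np + nd) -> R[i]) : R[i] :=
  creal ((np%:R * rho)^-1) * \sum_(a < np) conjc (xp a) * y (lshift nd a).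

Definition metric_q (np nd : nat) (rho : R) (xp : 'I_np -> R[i])
  (x y : 'I_(np + nd) -> R[i]) : R :=
  \prod_(b < nd)
     expR (- cnorm2 (y (rshift np b) - chan_est rho xp y * x (rshift np b))).

(* generalized information density  i_s(x, y), where the expectation is over
   Xbar = [x^(p), Xbar^(d)], Xbar^(d) ~ P_{X^(d)}; P_{X^(d)} is represented as
   the image of the probability PD on D under phi. *)
Definition info_dens (np nd : nat) (rho s : R) (xp : 'I_np -> R[i])
  (dD : measure_display) (D : measurableType dD) (PD : probability D R)
  (phi : D -> 'I_nd -> R[i]) (x y : 'I_(np + nd) -> R[i]) : R :=
  ln (powR (metric_q rho xp x y) s /
      fine (\int[PD]_dd (powR (metric_q rho xp (catv xp (phi dd)) y) s)%:E)%E).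

(* truncated first hitting time: hit n f = inf{v >= 1 : f v} if this is <= n,
   and n.+1 otherwise.  Hence  min(n, tau) = minn n (hit n f)  and
   tau > n  <->  n < hit n f. *)
Definition hit (n : nat) (f : nat -> bool) : nat := (find f (iota 1 n)).+1.

End Basic.

Section Indep.
Context {R : realType}.

Definition rv_sigma (dT : measure_display) (T : measurableType dT)
  (dV : measure_display) (V : measurableType dV) (X : T -> V) : set (set T) :=
  [set X @^-1` B | B in measurable].

Definition mutual_indep (dT : measure_display) (T : measurableType dT)
  (P : probability T R) (I : Type) (F : I -> set (set T)) : Prop :=
  forall (n : nat) (f : 'I_n -> I), injective f ->
  forall A : 'I_n -> set T, (forall t, F (f t) (A t)) ->
  P (\big[setI/setT]_(t < n) A t) = (\prod_(t < n) P (A t))%E.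

End Indep.

Inductive rv_idx (L n : nat) : Type :=
  | IX  of nat & 'I_L
  | IXb of nat & 'I_L
  | IHr of nat & 'I_L
  | IHi of nat & 'I_L
  | IWr of nat & 'I_L & 'I_n
  | IWi of nat & 'I_L & 'I_n.

Section Model.
Context {R : realType}.
Variables (L np nd : nat) (rho : R) (xp : 'I_np -> R[i]).
Variables (dD : measure_display) (D : measurableType dD) (PD : probability D R)
          (phi : D -> 'I_nd -> R[i]).
Variables (dO : measure_display) (Omega : measurableType dO)
          (P : probability Omega R).
Variables (Xd Xbd : nat -> 'I_L -> Omega -> D)
          (Hr Hi : nat -> 'I_L -> Omega -> R)
          (Wr Wi : nat -> 'I_L -> 'I_(np + nd) -> Omega -> R).

Definition Hc j k w : R[i] := Complex (Hr j k w) (Hi j k w).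
Definition Wc j k i w : R[i] := Complex (Wr j k i w) (Wi j k i w).

Definition chan_out j k (x : 'I_(np + nd) -> R[i]) w : 'I_(np + nd) -> R[i] :=
  fun i => Hc j k w * x i + Wc j k i w.

Definition model_sigma (t : rv_idx L (np + nd)) : set (set Omega) :=
  match t with
  | IX j k => rv_sigma (Xd j k)
  | IXb j k => rv_sigma (Xbd j k)
  | IHr j k => rv_sigma (Hr j k)
  | IHi j k => rv_sigma (Hi j k)
  | IWr j k i => rv_sigma (Wr j k i)
  | IWi j k i => rv_sigma (Wi j k i)
  end.

(* standing assumptions: X^(d)_{j,k}, Xbar^(d)_{j,k} ~ P_{X^(d)} (= phi # PD),
   H_{j,k} ~ CN(0,1), W_{j,k} ~ CN(0, I) (real and imaginary parts i.i.d.
   N(0, 1/2)), all mutually independent. *)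
Definition std_half : R := Num.sqrt (2^-1).

Definition model_assumptions : Prop :=
  [/\ (forall j k, measurable_fun setT (Xd j k) /\ measurable_fun setT (Xbd j k)),
      (forall j k, measurable_fun setT (Hr j k) /\ measurable_fun setT (Hi j k)),
      (forall j k i, measurable_fun setT (Wr j k i) /\ measurable_fun setT (Wi j k i)) &
   [/\
      (forall j k (B : set D), measurable B ->
         P (Xd j k @^-1` B) = PD B /\ P (Xbd j k @^-1` B) = PD B),
      (forall j k (B : set R), measurable B ->
         P (Hr j k @^-1` B) = normal_prob 0 std_half B /\
         P (Hi j k @^-1` B) = normal_prob 0 std_half B),
      (forall j k i (B : set R), measurable B ->
         P (Wr j k i @^-1` B) = normal_prob 0 std_half B /\
         P (Wi j k i @^-1` B) = normal_prob 0 std_half B) &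
      mutual_indep P model_sigma]].

Definition Xin j k w : 'I_(np + nd) -> R[i] := catv xp (phi (Xd j k w)).
Definition Xbin j k w : 'I_(np + nd) -> R[i] := catv xp (phi (Xbd j k w)).
Definition Yin j k w : 'I_(np + nd) -> R[i] := chan_out j k (Xin j k w) w.

Variable (s : R).
Definition acc_dens v w : R :=
  \sum_(j < v) \sum_(k < L) info_dens rho s xp PD phi (Xin j k w) (Yin j k w).
Definition acc_dens_bar v w : R :=
  \sum_(j < v) \sum_(k < L) info_dens rho s xp PD phi (Xbin j k w) (Yin j k w).

Variables (M lmax : nat).

Definition outputs := 'I_lmax -> 'I_L -> 'I_(np + nd) -> R[i].

Record vlsf_code := VLSFCode {
  pU : R;                                  (* P[U = true]; U takes values in bool *)
  enc : bool -> 'I_M -> 'I_lmax -> 'I_L -> 'I_(np + nd) -> R[i];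
  dec : bool -> nat -> outputs -> 'I_M;
  tstop : bool -> outputs -> nat
}.

Definition wU (c : vlsf_code) (u : bool) : R := if u then pU c else 1 - pU c.

Definition Ycode (c : vlsf_code) u m w : outputs :=
  fun j k => chan_out j k (enc c u m j k) w.

Definition is_vlsf_code (c : vlsf_code) : Prop :=
  [/\ 0 <= pU c <= 1,
      (forall u m j k, vnorm2 (enc c u m j k) = (np + nd)%:R * rho) &
   [/\
      (forall u v (y y' : outputs), (forall j : 'I_lmax, (j < v)%N -> y j = y' j) ->
         dec c u v y = dec c u v y'),
      (* tau^* is a stopping time for sigma(U, Y_1, ..., Y_v), 1 <= v <= lmax *)
      (forall u y, (1 <= tstop c u y <= lmax)%N),
      (forall u v (y y' : outputs), (forall j : 'I_lmax, (j < v)%N -> y j = y' j) ->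
         (tstop c u y <= v)%N = (tstop c u y' <= v)%N) &
      (forall u m v, measurable [set w | tstop c u (Ycode c u m w) = v] /\
         measurable [set w | dec c u (tstop c u (Ycode c u m w)) (Ycode c u m w) != m])]].

(* E[tau^*]  with J uniform on {1..M} and U independent of J and the channel *)
Definition code_len (c : vlsf_code) : \bar R :=
  (\sum_(u : bool) (wU c u)%:E * (M%:R^-1)%:E *
     \sum_(m < M) \int[P]_w ((tstop c u (Ycode c u m w))%:R)%:E)%E.

Definition code_err (c : vlsf_code) : \bar R :=
  (\sum_(u : bool) (wU c u)%:E * (M%:R^-1)%:E *
     \sum_(m < M) P [set w | dec c u (tstop c u (Ycode c u m w)) (Ycode c u m w) != m])%E.

End Model.

(* Main.v *)
(** Random coding with a threshold decoder: the receiver stops as soon as the accumulated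
    information density of some codeword reaches [gamma], and declares such a codeword.  If [m]
    is sent, it stops no later than [min lmax tau_m], and an error forces [tau_m > lmax] or
    [tau_m' <= min lmax tau_m] for some [m' <> m].  For an i.i.d. codebook independent of the
    channel, [(codeword m, codeword m', channel)] has the law of [(X, Xbar, channel)], so the
    mean length and the mean error probability of the random code obey the two bounds.  The
    rounds of the process [X] beyond [lmax] supply as many independent codewords as needed, so
    the codebook can be drawn from an independent copy of [Omega].  Finally the pair (mean
    length, mean error) dominates a convex combination of the values at two codebooks, which
    is why a binary [U] suffices. *)

Require Import Defs.
From HB Require Import structures.
From mathcomp Require Import all_boot all_order all_algebra.
From mathcomp Require Import all_classical all_reals all_analysis.
From mathcomp Require Import measurable_realfun complex ring lra.

Set Implicit Arguments.
Unset Strict Implicit.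
Unset Printing Implicit Defensive.

Import Order.TTheory GRing.Theory Num.Theory.
Local Open Scope ring_scope.
Local Open Scope classical_set_scope.

(** * Finite product spaces *)

Section FiniteProduct.
Context {I : finType} {d : measure_display} {V : measurableType d}.

Definition cylinders : set (set (I -> V)) :=
  [set S | exists2 B : I -> set V, (forall i, measurable (B i)) &
                                   S = [set e | forall i, B i (e i)]].

(** The product sigma-algebra: since [I] is finite, boxes constraining every coordinate at once
    generate it. *)
Definition prod_space : measurableType _ := g_sigma_algebraType cylinders.

Lemma cylinders_setI : setI_closed cylinders.
Proof.
move=> _ _ [B mB ->] [C mC ->]; exists (fun i => B i `&` C i).
  by move=> i; exact: measurableI.
apply/seteqP; split=> e /=.
  by move=> [Be Ce] i; split.
by move=> BCe; split=> i; have [] := BCe i.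
Qed.

Lemma cylinders_setT : cylinders [set: I -> V].
Proof. by exists (fun _ => setT) => //; apply/seteqP; split. Qed.

Lemma measurable_coord (i : I) :
  measurable_fun setT (fun e : prod_space => e i).
Proof.
move=> _ B mB; rewrite setTI; apply: sub_sigma_algebra.
exists (fun j => if j == i then B else setT).
  by move=> j; case: ifP.
apply/seteqP; split=> e /=.
  by move=> Bei j; case: eqP => [->|].
by move=> /(_ i); rewrite eqxx.
Qed.

Lemma measurable_cylinder {d' : measure_display} {T : measurableType d'}
    (Z : T -> I -> V) (B : I -> set V) :
  (forall i, measurable_fun setT (Z ^~ i)) -> (forall i, measurable (B i)) ->
  measurable [set t | forall i, B i (Z t i)].
Proof.
move=> mZ mB.
rewrite (_ : [set _ | _] = \bigcap_(i in [set: I]) (Z ^~ i @^-1` B i)); last first.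
  by apply/seteqP; split=> t BZ i; [move=> _; exact: BZ|exact: (BZ i Logic.I)].
apply: fin_bigcap_measurable => // i _.
by rewrite -[X in measurable X]setTI; exact: mZ.
Qed.

Lemma measurable_to_prod_space {d' : measure_display} {T : measurableType d'}
    (Z : T -> I -> V) :
  (forall i, measurable_fun setT (Z ^~ i)) ->
  measurable_fun setT (Z : T -> prod_space).
Proof.
move=> mZ; apply: (@measurability _ _ T prod_space setT Z cylinders) => //.
move=> _ [_ [B mB ->] <-]; rewrite setTI; exact: measurable_cylinder.
Qed.

(* A pi-lambda argument: the cylinders form a generating pi-system. *)
Lemma eq_law_of_cylinders {d1 d2 : measure_display} {T1 : measurableType d1}
    {T2 : measurableType d2} (R : realType) (mu1 : {measure set T1 -> \bar R})
    (mu2 : {measure set T2 -> \bar R}) (Z1 : T1 -> I -> V) (Z2 : T2 -> I -> V) :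
  (mu1 setT < +oo)%E ->
  (forall i, measurable_fun setT (Z1 ^~ i)) ->
  (forall i, measurable_fun setT (Z2 ^~ i)) ->
  (forall B : I -> set V, (forall i, measurable (B i)) ->
     mu1 [set t | forall i, B i (Z1 t i)] =
     mu2 [set t | forall i, B i (Z2 t i)]) ->
  forall S : set prod_space, measurable S ->
    mu1 (Z1 @^-1` S) = mu2 (Z2 @^-1` S).
Proof.
move=> mu1oo mZ1 mZ2 eqB S mS.
have mZ1' := measurable_to_prod_space mZ1.
have mZ2' := measurable_to_prod_space mZ2.
pose f1 : {mfun T1 >-> prod_space} :=
  HB.pack (Z1 : T1 -> prod_space) (isMeasurableFun.Build _ _ _ _ _ mZ1').
pose f2 : {mfun T2 >-> prod_space} :=
  HB.pack (Z2 : T2 -> prod_space) (isMeasurableFun.Build _ _ _ _ _ mZ2').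
(* The exhausting sequence is constantly the whole space, which is itself a cylinder of finite
   mass. *)
apply: (@g_sigma_algebra_measure_unique _ R prod_space cylinders _ (fun=> setT) _ _
  (pushforward mu1 f1) (pushforward mu2 f2)) => //.
- exact: sub_sigma_algebra.
- by move=> _; exact: cylinders_setT.
- by apply/seteqP; split=> // t _; exists 0.
- exact: cylinders_setI.
- by move=> _ [B mB ->]; exact: eqB.
Qed.

End FiniteProduct.
Arguments prod_space : clear implicits.
Arguments prod_space I {d} V.

(** * Events determined by finitely many Boolean tests *)

Section Tables.
Context {d : measure_display} {T : measurableType d} {J : finType}.

(** There are only finitely many tables [J -> bool], so the event is a finite union of finite
    intersections of tests and their complements. Stopping times and decisions are all treated in
    this form. *)
Lemma measurable_bool_table (f : T -> J -> bool) (Q : (J -> bool) -> Prop) :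
  (forall j, measurable [set t | f t j]) -> measurable [set t | Q (f t)].
Proof.
move=> mf.
rewrite (_ : [set _ | _] = \bigcup_(g in [set g : {ffun J -> bool} | Q g])
    \bigcap_(j in [set: J]) [set t | f t j = g j]); last first.
  apply/seteqP; split=> t /=.
    move=> Qf; exists [ffun j => f t j] => /=.
      by rewrite (_ : (fun_of_fin _) = f t) //; apply/funext => j; rewrite ffunE.
    by move=> j _ /=; rewrite ffunE.
  move=> [g /= Qg fg]; rewrite (_ : f t = g) //.
  by apply/funext => j; exact: fg.
apply: fin_bigcup_measurable; first exact: finite_finset.
move=> g _; apply: fin_bigcap_measurable => [|j _]; first exact: finite_finset.
case: (g j); first exact: mf.
rewrite (_ : [set _ | _] = ~` [set t | f t j]).
  by apply: measurableC; exact: mf.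
by apply/seteqP; split=> t /=; case: (f t j).
Qed.

Lemma measurable_fun_bool_table {d' : measure_display} {U : measurableType d'}
    (f : T -> J -> bool) (h : (J -> bool) -> U) :
  (forall j, measurable [set t | f t j]) -> measurable_fun setT (fun t => h (f t)).
Proof.
move=> mf _ B mB; rewrite setTI.
exact: (@measurable_bool_table f (fun g => B (h g))).
Qed.

End Tables.

(** * Two values whose average is below the mean *)

Section TwoPoints.
Context {d : measure_display} {T : measurableType d} {R : realType}.
Variable P : probability T R.

(** Almost everywhere [h] equals its absolute value, whose integral is therefore both nonnegative
    and at most 0. *)
Lemma ae_eq0_of_integral_le0 (h : T -> R) :
  P.-integrable setT (EFin \o h) -> (\int[P]_w (h w)%:E <= 0)%E ->
  {ae P, forall w, 0 <= h w} -> {ae P, forall w, h w = 0}.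
Proof.
move=> ih h_le0 h_ge0.
have [mh _] := integrableP _ _ _ ih.
have /ae_eq_integral_abs : (\int[P]_w `|(EFin \o h) w| = 0)%E.
  apply/eqP; rewrite eq_le integral_ge0 ?andbT //.
  rewrite (le_trans _ h_le0) // le_eqVlt; apply/orP; left; apply/eqP.
  apply: ae_eq_integral => //.
    exact: measurableT_comp.
  by apply: filterS h_ge0 => w hw _ /=; rewrite ger0_norm.
move=> /(_ measurableT mh); apply: filterS => w /(_ Logic.I) /=.
by move=> [].
Qed.

Lemma ae_exists (Q : T -> Prop) : {ae P, forall w, Q w} -> exists w, Q w.
Proof.
move=> aeQ; apply: contrapT => nQ.
have : {ae P, forall w : T, False} by apply: filterS aeQ => w Qw; apply: nQ; exists w.
move=> [N [mN PN0 sub]].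
have NT : N = setT by rewrite -subTset => w _; exact: sub.
by move: PN0; rewrite NT probability_setT => /eqP; rewrite onee_eq0.
Qed.

(** If [h] were positive wherever [Q] holds, it would be nonnegative almost everywhere with integral
    at most 0, hence almost everywhere 0, a contradiction. *)
Lemma exists_le_mean (h : T -> R) (Q : T -> Prop) :
  P.-integrable setT (EFin \o h) -> (\int[P]_w (h w)%:E <= 0)%E ->
  {ae P, forall w, Q w} -> exists2 w, Q w & h w <= 0.
Proof.
move=> ih h_le0 aeQ; apply: contrapT => nQ.
have gt0 w : Q w -> 0 < h w.
  by move=> Qw; rewrite ltNge; apply/negP => hw; apply: nQ; exists w.
have h_eq0 : {ae P, forall w, h w = 0}.
  by apply: ae_eq0_of_integral_le0 => //; apply: filterS aeQ => w /gt0 /ltW.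
have [|w [/gt0]] := @ae_exists (fun w => Q w /\ h w = 0).
  by apply: filterS2 aeQ h_eq0 => w; split.
by move=> + hw; rewrite hw ltxx.
Qed.

(* The mean of [(a, b)] dominates a convex combination of two of its values:
   otherwise a line [x + theta * y = 0] with [theta >= 0] would have all values on one side,
   hence almost all values on it, and two points of that line on either side of the origin
   do have a suitable convex combination. *)
Lemma two_point_centered (a b : T -> R) (Q : T -> Prop) :
  P.-integrable setT (EFin \o a) -> P.-integrable setT (EFin \o b) ->
  (\int[P]_w (a w)%:E <= 0)%E -> (\int[P]_w (b w)%:E <= 0)%E ->
  {ae P, forall w, Q w} ->
  exists w1 w2 (p : R), [/\ Q w1, Q w2, 0 <= p <= 1,
    p * a w1 + (1 - p) * a w2 <= 0 & p * b w1 + (1 - p) * b w2 <= 0].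
Proof.
move=> ia ib a_le0 b_le0 aeQ; apply: contrapT => none.
have single w : Q w -> ~~ ((a w <= 0) && (b w <= 0)).
  move=> Qw; apply/negP => /andP[aw bw]; apply: none; exists w, w, 1.
  by split; rewrite ?subrr ?mul0r ?addr0 ?mul1r // ler01 lexx.
have b_gt0 w : Q w -> a w <= 0 -> 0 < b w.
  by move=> /single; rewrite ltNge => + aw; rewrite aw.
have a_gt0 w : Q w -> b w <= 0 -> 0 < a w.
  by move=> /single; rewrite ltNge => + bw; rewrite bw andbT.
have pair w1 w2 : Q w1 -> Q w2 -> a w1 <= 0 -> b w2 <= 0 ->
    a w1 * b w2 < b w1 * a w2.
  move=> Q1 Q2 a1 b2; rewrite ltNge; apply/negP => le12; apply: none.
  have a2 := a_gt0 _ Q2 b2.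
  have dp : 0 < a w2 - a w1 by lra.
  have dp0 : a w2 - a w1 != 0 by rewrite gt_eqF.
  (* This weight makes the combination of the [a] values exactly 0; that of the [b] values is then
     nonpositive by [le12]. *)
  exists w1, w2, (a w2 / (a w2 - a w1)); split => //.
  - rewrite divr_ge0 ?(ltW dp) ?(ltW a2) //= ler_pdivrMr // mul1r; lra.
  - rewrite le_eqVlt; apply/orP; left; by apply/eqP; field.
  - rewrite (_ : _ * b w1 + _ =
      (a w2 * b w1 - a w1 * b w2) / (a w2 - a w1)); last by field.
    by rewrite pmulr_lle0 ?invr_gt0 // subr_le0 mulrC.
have [w0 Q0 a0] := exists_le_mean ia a_le0 aeQ.
have [[v0 Qv0 bv0]|nv0] := pselect (exists2 v, Q v & b v < 0); last first.
  (* With [b] never negative on [Q], its integral forces [b = 0] almost everywhere, and a point with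
     [a <= 0] there contradicts [single]. *)
  have b_eq0 : {ae P, forall w, b w = 0}.
    apply: ae_eq0_of_integral_le0 => //; apply: filterS aeQ => w Qw.
    by rewrite leNgt; apply/negP => bw; apply: nv0; exists w.
  have [|w [Qw bw] aw] := @exists_le_mean a (fun w => Q w /\ b w = 0) ia a_le0.
    by apply: filterS2 aeQ b_eq0 => w; split.
  by have := single w Qw; rewrite aw bw lexx.
(* Slopes [- a / b] of the points with [a <= 0]. By [pair], each point with [b < 0] bounds them all
   by [a / - b], so their supremum [theta] gives a line with every good point on its nonnegative
   side. *)
pose S := [set - a w / b w | w in [set w | Q w /\ a w <= 0]].
have ubS v : Q v -> b v < 0 -> ubound S (a v / - b v).
  move=> Qv bv _ [w [Qw aw] <-].
  have bw := b_gt0 _ Qw aw.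
  rewrite ler_pdivrMr // mulrAC ler_pdivlMr; last by lra.
  by have := pair _ _ Qw Qv aw (ltW bv); lra.
have S0 : S (- a w0 / b w0) by exists w0.
have hubS : has_ubound S by exists (a v0 / - b v0); exact: ubS.
pose theta := sup S.
have theta_ge0 : 0 <= theta.
  apply: le_trans (ub_le_sup hubS S0).
  by rewrite divr_ge0 ?oppr_ge0 // ltW // b_gt0.
have line_ge0 w : Q w -> 0 <= a w + theta * b w.
  move=> Qw; have [aw|aw] := leP (a w) 0.
    have bw := b_gt0 _ Qw aw.
    have : - a w / b w <= theta by apply: ub_le_sup => //; exists w.
    by rewrite ler_pdivrMr //; lra.
  have [bw|bw] := leP 0 (b w).
    by rewrite addr_ge0 ?(ltW aw) // mulr_ge0.
  have : theta <= a w / - b w.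
    by apply: ge_sup; [exists (- a w0 / b w0)|exact: ubS].
  by rewrite ler_pdivlMr; lra.
(* Since [theta >= 0], the integral of [a + theta * b] is at most 0, while the function itself is
   nonnegative on [Q]. *)
have line_eq0 : {ae P, forall w, a w + theta * b w = 0}.
  have itb : P.-integrable setT (fun w => theta%:E * (EFin \o b) w)%E.
    exact: integrableZl.
  apply: ae_eq0_of_integral_le0.
  - exact: (@integrableD _ _ _ P setT measurableT _ _ ia itb).
  - rewrite (_ : (\int[P]_w _)%E =
      (\int[P]_w (a w)%:E + theta%:E * \int[P]_w (b w)%:E)%E).
      by rewrite adde_le0 // mule_ge0_le0 // lee_fin.
    by rewrite -integralZl // -integralD.
  - by apply: filterS aeQ.
have aeQline : {ae P, forall w, Q w /\ a w + theta * b w = 0}.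
  by apply: filterS2 aeQ line_eq0 => w; split.
have [w1 [Q1 l1] a1] := exists_le_mean ia a_le0 aeQline.
have [w2 [Q2 l2] b2] := exists_le_mean ib b_le0 aeQline.
(* On the line both sides of the strict inequality equal [- theta * b w1 * b w2]. *)
have := pair _ _ Q1 Q2 a1 b2.
have -> : a w1 = - (theta * b w1) by lra.
have -> : a w2 = - (theta * b w2) by lra.
by rewrite mulNr mulrN mulrCA mulrA ltxx.
Qed.

(** Subtracting [A] and [B] reduces to the centered case; the weights sum to 1, so the shift
    cancels. *)
Lemma two_point_below_mean (f g : T -> R) (A B : R) (Q : T -> Prop) :
  P.-integrable setT (EFin \o f) -> P.-integrable setT (EFin \o g) ->
  (\int[P]_w (f w)%:E <= A%:E)%E -> (\int[P]_w (g w)%:E <= B%:E)%E ->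
  {ae P, forall w, Q w} ->
  exists w1 w2 (p : R), [/\ Q w1, Q w2, 0 <= p <= 1,
    p * f w1 + (1 - p) * f w2 <= A & p * g w1 + (1 - p) * g w2 <= B].
Proof.
move=> intf intg fA gB aeQ.
have cst_int (c : R) : P.-integrable setT (EFin \o cst c).
  exact: finite_measure_integrable_cst.
have int_sub (h : T -> R) (c : R) : P.-integrable setT (EFin \o h) ->
    P.-integrable setT (EFin \o (fun w => h w - c)).
  by move=> ih; exact: (@integrableB _ _ _ P setT measurableT _ _ ih (cst_int c)).
have le0_sub (h : T -> R) (c : R) : P.-integrable setT (EFin \o h) ->
    (\int[P]_w (h w)%:E <= c%:E)%E -> (\int[P]_w (h w - c)%:E <= 0)%E.
  move=> ih hc; rewrite (_ : (\int[P]_w _)%E = (\int[P]_w (h w)%:E - c%:E)%E).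
    by rewrite sube_le0.
  have -> := @integralB _ _ _ P setT measurableT _ _ ih (cst_int c).
  congr (_ - _)%E; rewrite (_ : EFin \o cst c = cst c%:E) // integral_cst //.
  by rewrite -[X in (_ * X)%E]/(P setT) probability_setT mule1.
have [w1 [w2 [p [Q1 Q2 p01 Hf Hg]]]] := two_point_centered
  (int_sub _ A intf) (int_sub _ B intg) (le0_sub _ _ intf fA) (le0_sub _ _ intg gB) aeQ.
by exists w1, w2, p; split=> //; lra.
Qed.

End TwoPoints.

(** * Measurability of the information density *)

Section ComplexMeasurability.
Context {R : realType} {d : measure_display} {T : measurableType d}.

Definition cmeasurable (f : T -> R[i]) : Prop :=
  measurable_fun setT (fun t => complex.Re (f t)) /\
  measurable_fun setT (fun t => complex.Im (f t)).

Lemma cmeasurable_cst (c : R[i]) : cmeasurable (fun=> c).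
Proof. by split; exact: measurable_cst. Qed.

Lemma cmeasurableD (f g : T -> R[i]) :
  cmeasurable f -> cmeasurable g -> cmeasurable (fun t => f t + g t).
Proof.
move=> [fr fi] [gr gi]; split.
  rewrite (_ : (fun _ => _) = (fun t => complex.Re (f t) + complex.Re (g t))).
    exact: measurable_funD.
  by apply/funext => t; case: (f t) (g t) => [? ?] [].
rewrite (_ : (fun _ => _) = (fun t => complex.Im (f t) + complex.Im (g t))).
  exact: measurable_funD.
by apply/funext => t; case: (f t) (g t) => [? ?] [].
Qed.

Lemma cmeasurableN (f : T -> R[i]) :
  cmeasurable f -> cmeasurable (fun t => - f t).
Proof.
move=> [fr fi]; split.
  rewrite (_ : (fun _ => _) = (fun t => - complex.Re (f t))).
    exact: measurableT_comp.
  by apply/funext => t; case: (f t).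
rewrite (_ : (fun _ => _) = (fun t => - complex.Im (f t))).
  exact: measurableT_comp.
by apply/funext => t; case: (f t).
Qed.

Lemma cmeasurableM (f g : T -> R[i]) :
  cmeasurable f -> cmeasurable g -> cmeasurable (fun t => f t * g t).
Proof.
move=> [fr fi] [gr gi]; split.
  rewrite (_ : (fun _ => _) = (fun t => complex.Re (f t) * complex.Re (g t) -
                                        complex.Im (f t) * complex.Im (g t))).
    by apply: measurable_funB; exact: measurable_funM.
  by apply/funext => t; case: (f t) (g t) => [? ?] [].
rewrite (_ : (fun _ => _) = (fun t => complex.Re (f t) * complex.Im (g t) +
                                      complex.Im (f t) * complex.Re (g t))).
  by apply: measurable_funD; exact: measurable_funM.
by apply/funext => t; case: (f t) (g t) => [? ?] [].
Qed.

Lemma cmeasurable_sum (I : Type) (s : seq I) (f : I -> T -> R[i]) :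
  (forall i, cmeasurable (f i)) -> cmeasurable (fun t => \sum_(i <- s) f i t).
Proof.
move=> mf; elim: s => [|i s IH].
  by under eq_fun do rewrite big_nil; exact: cmeasurable_cst.
by under eq_fun do rewrite big_cons; exact: cmeasurableD.
Qed.

Lemma measurable_cnorm2 (f : T -> R[i]) :
  cmeasurable f -> measurable_fun setT (fun t => cnorm2 (f t)).
Proof.
by move=> [fr fi]; apply: measurable_funD; exact: measurable_funX.
Qed.

Lemma cmeasurable_comp {d' : measure_display} {T' : measurableType d'}
    (f : T' -> R[i]) (g : T -> T') :
  measurable_fun setT (fun t => complex.Re (f t)) ->
  measurable_fun setT (fun t => complex.Im (f t)) ->
  measurable_fun setT g -> cmeasurable (fun t => f (g t)).
Proof.
by move=> fr fi mg; split; [exact: (measurableT_comp fr mg)|exact: (measurableT_comp fi mg)].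
Qed.

End ComplexMeasurability.

Section InformationDensity.
Context {R : realType} {np nd : nat} (rho s : R) (xp : 'I_np -> R[i]).

Lemma measurable_metric_q {d : measure_display} {T : measurableType d}
    (x y : T -> 'I_(np + nd) -> R[i]) :
  (forall i, cmeasurable (x ^~ i)) -> (forall i, cmeasurable (y ^~ i)) ->
  measurable_fun setT (fun t => metric_q rho xp (x t) (y t)).
Proof.
move=> mx my; apply: measurable_prod => b _.
apply: measurableT_comp => //; apply: measurableT_comp => //.
apply: measurable_cnorm2; apply: cmeasurableD => //; apply: cmeasurableN.
apply: cmeasurableM => //; apply: cmeasurableM; first exact: cmeasurable_cst.
by apply: cmeasurable_sum => a; apply: cmeasurableM => //; exact: cmeasurable_cst.
Qed.

Context {dD : measure_display} {D : measurableType dD} (PD : probability D R).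
Context (phi : D -> 'I_nd -> R[i]).
Hypothesis mphi : forall b,
  measurable_fun setT (fun dd => complex.Re (phi dd b)) /\
  measurable_fun setT (fun dd => complex.Im (phi dd b)).

Lemma cmeasurable_catv {d : measure_display} {T : measurableType d}
    (X : T -> D) (i : 'I_(np + nd)) :
  measurable_fun setT X -> cmeasurable (fun t => catv xp (phi (X t)) i).
Proof.
move=> mX; rewrite /catv; case: (fintype.split i) => j.
  exact: cmeasurable_cst.
by have [] := mphi j; move=> *; exact: (@cmeasurable_comp _ _ _ _ _ (phi ^~ j)).
Qed.

Lemma measurable_info_dens {d : measure_display} {T : measurableType d}
    (x y : T -> 'I_(np + nd) -> R[i]) :
  (forall i, cmeasurable (x ^~ i)) -> (forall i, cmeasurable (y ^~ i)) ->
  measurable_fun setT (fun t => info_dens rho s xp PD phi (x t) (y t)).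
Proof.
move=> mx my.
pose q (t : T) (dd : D) := metric_q rho xp (catv xp (phi dd)) (y t) `^ s.
have q_ge0 t dd : 0 <= q t dd by exact: powR_ge0.
have mq : measurable_fun setT (fun z : T * D => (q z.1 z.2)%:E).
  apply/measurable_EFinP.
  apply: (measurableT_comp (measurable_powR s)).
  apply: measurable_metric_q => i.
    by apply: cmeasurable_catv; exact: measurable_snd.
  have [yr yi] := my i.
  by apply: (@cmeasurable_comp _ _ _ _ _ (y ^~ i)) => //; exact: measurable_fst.
(* Tonelli: the partial integral of a jointly measurable nonnegative function is measurable in the
   remaining variable. *)
have mden : measurable_fun setT (fun t => (\int[PD]_dd (q t dd)%:E)%E).
  apply: (@measurable_fun_fubini_tonelli_F _ _ _ _ _ PD
    (fun z : T * D => (q z.1 z.2)%:E)) => //.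
  by move=> z; rewrite lee_fin.
have mfden : measurable_fun setT (fun t => (fine (\int[PD]_dd (q t dd)%:E)%E)).
  exact: measurableT_comp.
(* The reciprocal becomes a power with exponent [-1], a measurable function agreeing with the
   inverse on nonnegative reals, 0 included. *)
rewrite (_ : (fun _ => _) = (fun t => ln (metric_q rho xp (x t) (y t) `^ s *
    (fine (\int[PD]_dd (q t dd)%:E)%E) `^ (-1)))); last first.
  apply/funext => t; rewrite /info_dens powR_inv1 //.
  by rewrite fine_ge0 //; apply: integral_ge0 => dd _; rewrite lee_fin.
apply: measurableT_comp; first exact: measurable_ln.
apply: measurable_funM.
  by apply: (measurableT_comp (measurable_powR s)); exact: measurable_metric_q.
exact: (measurableT_comp (measurable_powR (-1))).
Qed.

End InformationDensity.

(** * First hitting times *)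

Section Hitting.
Implicit Types (f g : nat -> bool) (n v : nat).

Lemma hit_gt0 n f : (0 < hit n f)%N. Proof. by []. Qed.

(** The value [n.+1], which encodes the absence of a hit, accounts for the first disjunct. *)
Lemma hit_leE n f v : (hit n f <= v)%N = (n < v)%N || has f (iota 1 v).
Proof.
rewrite /hit; have [nv|vn] /= := ltnP n v.
  by rewrite (leq_ltn_trans (find_size _ _)) // size_iota.
rewrite -[in LHS](subnKC vn) iotaD find_cat size_iota.
have [fv|nfv] := boolP (has f (iota 1 v)); last by rewrite ltnNge leq_addr.
by rewrite has_find size_iota in fv.
Qed.

Lemma hit_le_succ n f : (hit n f <= n.+1)%N.
Proof. by rewrite hit_leE ltnSn. Qed.

Lemma hit_le_of n f v : (0 < v)%N -> f v -> (hit n f <= v)%N.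
Proof.
move=> v0 fv; rewrite hit_leE; apply/orP; right; apply/hasP; exists v => //.
by rewrite mem_iota v0 add1n ltnS leqnn.
Qed.

Lemma hit_holds n f : (hit n f <= n)%N -> f (hit n f).
Proof.
rewrite /hit => lt_n; have hf : has f (iota 1 n) by rewrite has_find size_iota.
by have := nth_find 0 hf; rewrite nth_iota.
Qed.

Lemma eq_hit n f g :
  (forall v, (0 < v <= n)%N -> f v = g v) -> hit n f = hit n g.
Proof.
move=> fg; rewrite /hit; congr S; apply: eq_in_find => v.
by rewrite mem_iota add1n ltnS; exact: fg.
Qed.

End Hitting.

(** * Stopping at the first crossing among finitely many candidates *)

Section FirstCrossing.
Context {I : finType} (n : nat) (F : I -> nat -> bool) (i0 : I).
Hypothesis n0 : (0 < n)%N.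

(** Searching only up to [n.-1] makes the no-hit value equal to [n], which forces a stop in round
    [n] whether or not a candidate crosses. *)
Definition stop_time : nat := hit n.-1 (fun v => [exists i, F i v]).
(** The default [i0] matters at a forced stop where no candidate passes its test. *)
Definition decision (v : nat) : I := odflt i0 [pick i | F i v].

Lemma stop_time_range : (1 <= stop_time <= n)%N.
Proof. by rewrite hit_gt0 /= -[leqRHS](prednK n0) hit_le_succ. Qed.

Lemma stop_time_le (i : I) : (stop_time <= minn n (hit n (F i)))%N.
Proof.
rewrite leq_min; apply/andP; split; first by have /andP[] := stop_time_range.
have := leqnn (hit n (F i)); rewrite {1}hit_leE => /orP[lt_n|/hasP[v]].
  by rewrite hit_leE (leq_ltn_trans (leq_pred n)).
rewrite mem_iota add1n ltnS => /andP[v0 vle] Fv; apply: leq_trans vle.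
by apply: hit_le_of => //; apply/existsP; exists i.
Qed.

(** If [i] crosses by [n] and every other candidate strictly later, the first crossing is that of
    [i], and [i] alone passes its test there. *)
Lemma decision_error (i : I) : decision stop_time != i ->
  (n < hit n (F i))%N \/
  exists2 j, j != i & (hit n (F j) <= minn n (hit n (F i)))%N.
Proof.
move=> err; have [|hi] := ltnP n (hit n (F i)); [by left|right].
apply: contrapT => none.
have later j : j != i -> (hit n (F i) < hit n (F j))%N.
  by move=> ji; rewrite ltnNge; apply/negP => hj; apply: none; exists j.
have stop_eq : stop_time = hit n (F i).
  apply/eqP; rewrite eqn_leq (leq_trans (stop_time_le i)) ?geq_minr //=.
  rewrite leqNgt; apply/negP => lt_i.
  (* A stop before [hit n (F i) <= n] occurs by round [n.-1], so it is a genuine crossing and not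
     the forced stop. *)
  have : [exists j, F j stop_time].
    by apply: (@hit_holds n.-1 (fun v => [exists j, F j v]));
      rewrite -ltnS prednK // (leq_trans lt_i).
  move=> /existsP[j Fj].
  have hj : (hit n (F j) < hit n (F i))%N.
    by apply: leq_ltn_trans lt_i; apply: hit_le_of => //; have /andP[] := stop_time_range.
  have [ji|ji] := eqVneq j i; first by rewrite ji ltnn in hj.
  by have := ltn_trans hj (later j ji); rewrite ltnn.
move/eqP: err; apply; rewrite stop_eq /decision; case: pickP => [j Fj|/(_ i)] /=.
  apply/eqP; apply: contraT => ji; have := later j ji.
  by rewrite ltnNge (hit_le_of n _ Fj).
by rewrite (hit_holds hi).
Qed.

End FirstCrossing.

(** * The random codebook *)

Section JointLaw.
Context {R : realType} (L np nd lmax : nat).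
Context {dD : measure_display} {D : measurableType dD} (PD : probability D R).
Context {dO : measure_display} {Omega : measurableType dO}
  (P : probability Omega R).
Context (Xd Xbd : nat -> 'I_L -> Omega -> D) (Hr Hi : nat -> 'I_L -> Omega -> R)
  (Wr Wi : nat -> 'I_L -> 'I_(np + nd) -> Omega -> R).
Local Notation n := (np + nd)%N.

(* All variables are made to take values in the single space [D * R]; the unused
   component is constant. *)
Definition model_var (t : rv_idx L n) (w : Omega) : D * R :=
  match t with
  | IX j k => (Xd j k w, 0)
  | IXb j k => (Xbd j k w, 0)
  | IHr j k => (point, Hr j k w)
  | IHi j k => (point, Hi j k w)
  | IWr j k i => (point, Wr j k i w)
  | IWi j k i => (point, Wi j k i w)
  end.

(* [inl (b, (j, k))]: data of block [(j, k)] of the transmitted ([b = false]) or of the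
   competing ([b = true]) word; [inr ((j, k), (b, o))]: real ([b = false]) or imaginary
   part of the fading ([o = None]) or of the [i]-th noise sample ([o = Some i]). *)
Definition word_idx : finType := (bool * ('I_lmax * 'I_L))%type.
Definition chan_idx : finType := (('I_lmax * 'I_L) * (bool * option 'I_n))%type.

Definition joint_space := prod_space (word_idx + chan_idx)%type (D * R)%type.

Definition chan_var (i : chan_idx) : rv_idx L n :=
  let: ((j, k), (im, o)) := i in
  match o with
  | None => if im then IHi n j k else IHr n j k
  | Some a => if im then IWi j k a else IWr j k a
  end.

Definition model_word_var (i : word_idx) : rv_idx L n :=
  let: (b, (j, k)) := i in if b then IXb n j k else IX n j k.

(* Codeword [m] of the random codebook consists of the inputs in rounds
   [m * lmax], ..., [m * lmax + lmax - 1]. *)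
Definition code_word_var (m m' : nat) (i : word_idx) : rv_idx L n :=
  let: (b, (j, k)) := i in IX n ((if b then m' else m) * lmax + j)%N k.

Definition model_idx (i : word_idx + chan_idx) : rv_idx L n :=
  match i with inl a => model_word_var a | inr c => chan_var c end.

Definition model_point (w : Omega) : joint_space :=
  fun i => model_var (model_idx i) w.

(* [z.1] draws the codebook, [z.2] the channel. *)
Definition code_point (m m' : nat) (z : Omega * Omega) : joint_space := fun i =>
  match i with
  | inl a => model_var (code_word_var m m' a) z.1
  | inr c => model_var (chan_var c) z.2
  end.

Hypothesis mX : forall j k, measurable_fun setT (Xd j k) /\ measurable_fun setT (Xbd j k).
Hypothesis mH : forall j k, measurable_fun setT (Hr j k) /\ measurable_fun setT (Hi j k).
Hypothesis mW : forall j k i, measurable_fun setT (Wr j k i) /\ measurable_fun setT (Wi j k i).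
Hypothesis lawX : forall j k (B : set D), measurable B ->
  P (Xd j k @^-1` B) = PD B /\ P (Xbd j k @^-1` B) = PD B.
Hypothesis indep : mutual_indep P (model_sigma Xd Xbd Hr Hi Wr Wi).

Lemma measurable_model_var t : measurable_fun setT (model_var t).
Proof.
case: t => [j k|j k|j k|j k|j k i|j k i] /=; apply: measurable_fun_pair => //=.
- by have [] := mX j k.
- by have [] := mX j k.
- by have [] := mH j k.
- by have [] := mH j k.
- by have [] := mW j k i.
- by have [] := mW j k i.
Qed.

Lemma model_sigma_model_var (t : rv_idx L n) (B : set (D * R)) : measurable B ->
  model_sigma Xd Xbd Hr Hi Wr Wi t (model_var t @^-1` B).
Proof.
have mD (C : set (D * R)) (r : R) : measurable C -> measurable ((pair^~ r) @^-1` C : set D).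
  by move=> mC; rewrite -[X in measurable X]setTI; exact: (pair2_measurable r).
have mR (C : set (D * R)) (x : D) : measurable C -> measurable (pair x @^-1` C : set R).
  by move=> mC; rewrite -[X in measurable X]setTI; exact: (pair1_measurable x).
case: t => [j k|j k|j k|j k|j k i|j k i] /= mB.
- by exists ((pair^~ 0) @^-1` B); [exact: mD|].
- by exists ((pair^~ 0) @^-1` B); [exact: mD|].
- by exists (pair point @^-1` B); [exact: mR|].
- by exists (pair point @^-1` B); [exact: mR|].
- by exists (pair point @^-1` B); [exact: mR|].
- by exists (pair point @^-1` B); [exact: mR|].
Qed.

(** Independence is stated for families over ordinals; enumerating [I] transfers it to any finite
    index type. *)
Lemma probability_box (I : finType) (g : I -> rv_idx L n) (B : I -> set (D * R)) :
  injective g -> (forall i, measurable (B i)) ->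
  P [set w | forall i, B i (model_var (g i) w)] =
  (\prod_i P (model_var (g i) @^-1` B i))%E.
Proof.
move=> g_inj mB.
have := indep (f := fun t : 'I_#|I| => g (enum_val t)) _
  (A := fun t => model_var (g (enum_val t)) @^-1` B (enum_val t)).
rewrite -(@big_enum_val _ _ _ I predT (fun i => P (model_var (g i) @^-1` B i))).
move=> <-; first last.
- by move=> t; exact: model_sigma_model_var.
- by move=> t t' /g_inj /enum_val_inj.
rewrite -bigcap_seq; congr (P _); apply/seteqP; split=> w Bw.
  by move=> t _; exact: Bw.
by move=> i; have := Bw (enum_rank i) (mem_index_enum _); rewrite /= enum_rankK.
Qed.

Lemma chan_var_inj : injective chan_var.
Proof.
by move=> [[j k] [[] [a|]]] [[j' k'] [[] [a'|]]] //= [] /ord_inj *; subst.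
Qed.

Lemma model_idx_inj : injective model_idx.
Proof.
move=> [[b [j k]]|[[j k] [b o]]] [[b' [j' k']]|[[j' k'] [b' o']]].
- by case: b b' => [] [] //= [] /ord_inj *; subst.
- by case: b b' o' => [] [] [a'|].
- by case: b b' o => [] [] [a|].
- by move=> /chan_var_inj ->.
Qed.

(** Dividing a round number by [lmax] recovers the message index, so distinct codewords use disjoint
    rounds. *)
Lemma code_word_var_inj m m' : m != m' -> injective (code_word_var m m').
Proof.
move=> mm' [b [j k]] [b' [j' k']] [] eq_round ->.
have l0 : (0 < lmax)%N by apply: leq_ltn_trans (ltn_ord j).
have quot (q : nat) (i : 'I_lmax) : ((q * lmax + i) %/ lmax)%N = q.
  by rewrite divnMDl // divn_small ?addn0.
have := congr1 (divn^~ lmax) eq_round; rewrite !quot => eq_m.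
have bb' : b = b'.
  by case: b b' eq_m {eq_round} => [] [] // eq_m; move: mm'; rewrite eq_m eqxx.
by move: eq_round; rewrite bb' => /addnI /ord_inj ->.
Qed.

(** Data blocks of both processes have law [PD] in every round, so replacing one block by another
    leaves the marginals unchanged. *)
Lemma probability_code_word_var (i : word_idx) m m' (B : set (D * R)) :
  measurable B ->
  P (model_var (code_word_var m m' i) @^-1` B) =
  P (model_var (model_idx (inl i)) @^-1` B).
Proof.
move=> mB.
have mB0 : measurable ((pair^~ (0 : R)) @^-1` B : set D).
  by rewrite -[X in measurable X]setTI; exact: (pair2_measurable (0 : R)).
case: i => [b [j k]].
have [-> _] := lawX ((if b then m' else m) * lmax + j) k mB0.
by case: b => /=; have [E1 E2] := lawX j k mB0.
Qed.

Lemma measurable_model_point : measurable_fun setT model_point.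
Proof. by apply: measurable_to_prod_space => i; exact: measurable_model_var. Qed.

Lemma measurable_code_coord m m' i :
  measurable_fun setT (fun z => code_point m m' z i).
Proof.
case: i => [a|c] /=.
  exact: (measurableT_comp (measurable_model_var _) measurable_fst).
exact: (measurableT_comp (measurable_model_var _) measurable_snd).
Qed.

Lemma measurable_code_point m m' : measurable_fun setT (code_point m m').
Proof. exact: (measurable_to_prod_space (measurable_code_coord m m')). Qed.

(** On a box both sides factor into the same marginals: the product measure separates codebook from
    channel, and independence splits each factor, with [m != m'] keeping the two codewords
    independent. *)
Lemma law_code_point m m' : m != m' ->
  forall S : set joint_space, measurable S ->
    (P \x P)%E (code_point m m' @^-1` S) = P (model_point @^-1` S).
Proof.
move=> mm'; apply: eq_law_of_cylinders.
- have := @product_measure1E _ _ _ _ _ P P setT setT measurableT measurableT.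
  rewrite setXTT => E; rewrite [ltLHS]E.
  by rewrite -[X in (X * X)%E]/(P setT) !probability_setT mule1 ltry.
- exact: measurable_code_coord.
- by move=> i; exact: measurable_model_var.
- move=> B mB.
  rewrite -[RHS]/(P [set w | forall i, B i (model_var (model_idx i) w)]).
  rewrite (probability_box model_idx_inj) //.
  pose A1 := [set w | forall a, B (inl a) (model_var (code_word_var m m' a) w)].
  pose A2 := [set w | forall c, B (inr c) (model_var (chan_var c) w)].
  have mA1 : measurable A1.
    apply: (measurable_cylinder (Z := fun w a => model_var (code_word_var m m' a) w)
      (B := fun a => B (inl a))) => // a; exact: measurable_model_var.
  have mA2 : measurable A2.
    apply: (measurable_cylinder (Z := fun w c => model_var (chan_var c) w)
      (B := fun c => B (inr c))) => // c; exact: measurable_model_var.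
  rewrite (_ : [set _ | _] = A1 `*` A2); last first.
    apply/seteqP; split=> z /=.
      by move=> Bz; split=> i; [exact: (Bz (inl i))|exact: (Bz (inr i))].
    by move=> [B1 B2] [a|c]; [exact: B1|exact: B2].
  have E := product_measure1E P P mA1 mA2.
  rewrite [LHS]E big_sumType /=; congr (_ * _)%E.
    have E1 := probability_box (code_word_var_inj mm') (fun a => mB (inl a)).
    rewrite [LHS]E1.
    by apply: eq_bigr => a _; exact: probability_code_word_var.
  exact: (probability_box chan_var_inj (fun c => mB (inr c))).
Qed.

(** Tonelli merges the two integrals into one over the product, and equality of laws moves it to
    [model_point]. *)
Lemma integral_code_point m m' (F : joint_space -> R) : m != m' ->
  measurable_fun setT F -> (forall e, 0 <= F e) ->
  (\int[P]_w' \int[P]_w (F (code_point m m' (w', w)))%:E =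
   \int[P]_w (F (model_point w))%:E)%E.
Proof.
move=> mm' mF F0.
have mEF : measurable_fun setT (EFin \o F) by exact/measurable_EFinP.
have mc := measurable_code_point m m'.
have mm := measurable_model_point.
pose c : {mfun (Omega * Omega)%type >-> joint_space} :=
  HB.pack (code_point m m') (isMeasurableFun.Build _ _ _ _ _ mc).
pose f : {mfun Omega >-> joint_space} :=
  HB.pack model_point (isMeasurableFun.Build _ _ _ _ _ mm).
have EF0 : {in setT, forall e, (0 <= (EFin \o F) e)%E}.
  by move=> e _; rewrite lee_fin.
have E1 := @ge0_integral_pushforward _ _ _ _ _ _ mc (P \x P)%E setT _ measurableT mEF EF0.
have E2 := @ge0_integral_pushforward _ _ _ _ _ _ mm P setT _ measurableT mEF EF0.
rewrite preimage_setT in E1; rewrite preimage_setT in E2.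
transitivity (\int[(P \x P)%E]_z ((EFin \o F) \o code_point m m') z)%E.
  rewrite fubini_tonelli1 //; first exact: (measurableT_comp mEF mc).
  by move=> z; rewrite lee_fin.
rewrite -[LHS]E1 -[RHS]E2.
apply: (@eq_measure_integral _ _ _ _ (pushforward P f) (pushforward (P \x P)%E c)).
by move=> A mA _; exact: law_code_point.
Qed.

(** * Means over the channel for a fixed codebook *)

Section CodebookMean.
Variables (F : joint_space -> R) (C : R).
Hypothesis mF : measurable_fun setT F.
Hypothesis F_range : forall e, 0 <= F e <= C.

(** The conditional mean of [F] given the codebook drawn at [w']; boundedness of [F] makes [fine]
    lossless. *)
Definition codebook_mean (m m' : nat) (w' : Omega) : R :=
  fine (\int[P]_w (F (code_point m m' (w', w)))%:E)%E.

Let F0 e : 0 <= F e. Proof. by have /andP[] := F_range e. Qed.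
Let FC e : F e <= C. Proof. by have /andP[] := F_range e. Qed.

Lemma measurable_code_slice m m' w' :
  measurable_fun setT (fun w => F (code_point m m' (w', w))).
Proof.
apply: (measurableT_comp mF).
exact: (measurableT_comp (measurable_code_point m m') (pair1_measurable w')).
Qed.

Lemma integral_code_slice_le m m' w' :
  (\int[P]_w (F (code_point m m' (w', w)))%:E <= C%:E)%E.
Proof.
have -> : C%:E = (\int[P]_w (cst C%:E w))%E.
  by rewrite integral_cst // -[X in (_ * X)%E]/(P setT) probability_setT mule1.
apply: ge0_le_integral => //.
- by move=> w _; rewrite lee_fin.
- exact/measurable_EFinP/measurable_code_slice.
- by move=> w _; rewrite lee_fin.
Qed.

Lemma codebook_meanE m m' w' : (codebook_mean m m' w')%:E =
  (\int[P]_w (F (code_point m m' (w', w)))%:E)%E.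
Proof.
rewrite fineK // ge0_fin_numE.
  by apply: le_lt_trans (integral_code_slice_le m m' w') _; rewrite ltry.
by apply: integral_ge0 => w _; rewrite lee_fin.
Qed.

Lemma integrable_code_slice m m' w' :
  P.-integrable setT (fun w => (F (code_point m m' (w', w)))%:E).
Proof.
apply/integrableP; split; first exact/measurable_EFinP/measurable_code_slice.
apply: le_lt_trans (ltry C).
under eq_integral do rewrite gee0_abs ?lee_fin //.
exact: integral_code_slice_le.
Qed.

Lemma integrable_codebook_mean m m' :
  P.-integrable setT (EFin \o codebook_mean m m').
Proof.
have -> : EFin \o codebook_mean m m' =
    (fun w' => \int[P]_w (F (code_point m m' (w', w)))%:E)%E.
  by apply/funext => w' /=; exact: codebook_meanE.
apply: (@le_integrable _ _ _ P _ measurableT _ (cst C%:E)).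
- apply: (@measurable_fun_fubini_tonelli_F _ _ _ _ _ P
    (fun z => (F (code_point m m' z))%:E)).
    by apply/measurable_EFinP; exact: (measurableT_comp mF (measurable_code_point m m')).
  by move=> z; rewrite lee_fin.
- move=> w' _; have C0 : 0 <= C by exact: le_trans (FC point).
  rewrite gee0_abs; last by apply: integral_ge0 => w _; rewrite lee_fin.
  by rewrite gee0_abs ?lee_fin // integral_code_slice_le.
- exact: finite_measure_integrable_cst.
Qed.

Lemma integral_codebook_mean m m' : m != m' ->
  (\int[P]_w' (codebook_mean m m' w')%:E = \int[P]_w (F (model_point w))%:E)%E.
Proof.
move=> mm'; rewrite -(integral_code_point mm' mF F0).
by apply: eq_integral => w' _; exact: codebook_meanE.
Qed.

End CodebookMean.

End JointLaw.

(** * The threshold code *)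

Section ThresholdCode.
Context {R : realType} (gamma s rho : R) (lmax M L np nd : nat)
  (xp : 'I_np -> R[i]).
Context {dD : measure_display} {D : measurableType dD} (PD : probability D R)
  (phi : D -> 'I_nd -> R[i]).
Hypothesis mphi : forall b,
  measurable_fun setT (fun dd => complex.Re (phi dd b)) /\
  measurable_fun setT (fun dd => complex.Im (phi dd b)).

Local Notation n := (np + nd)%N.
Local Notation blocks := (@outputs R L np nd lmax).

(** The sum runs over all [lmax] rounds with a guard, as words and outputs are tables over
    ['I_lmax]. *)
Definition acc_density (x y : blocks) (v : nat) : R :=
  \sum_(j < lmax | (j < v)%N) \sum_(k < L) info_dens rho s xp PD phi (x j k) (y j k).

(** The bounded index [v] makes the tests a finite table, as [measurable_bool_table] requires. *)
Definition crosses (x y : blocks) (v : 'I_lmax.+1) : bool :=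
  gamma <= acc_density x y v.

Lemma crosses_causal (x y y' : blocks) (v : nat) :
  (forall j : 'I_lmax, (j < v)%N -> y j = y' j) ->
  crosses x y (inord v) = crosses x y' (inord v).
Proof.
(* For [v] beyond [lmax], [inord v] falls back to 0, so the bound holds for every [v]. *)
move=> eq_y; have le_v : ((inord v : 'I_lmax.+1) <= v)%N.
  by rewrite /inord /insubd; case: insubP => [? _ ->|].
suff E : acc_density x y (inord v : 'I_lmax.+1) = acc_density x y' (inord v : 'I_lmax.+1).
  by rewrite /crosses E.
by rewrite /acc_density; apply: eq_bigr => j jv; rewrite (eq_y j) // (leq_trans jv le_v).
Qed.

Lemma measurable_crosses {d : measure_display} {T : measurableType d}
    (x y : T -> blocks) (v : 'I_lmax.+1) :
  (forall j k i, cmeasurable (fun t => x t j k i)) ->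
  (forall j k i, cmeasurable (fun t => y t j k i)) ->
  measurable [set t | crosses (x t) (y t) v].
Proof.
move=> mx my.
have mdens j k : measurable_fun setT
    (fun t => info_dens rho s xp PD phi (x t j k) (y t j k)).
  exact: measurable_info_dens (mx j k) (my j k).
have macc : measurable_fun setT (fun t => acc_density (x t) (y t) v).
  rewrite /acc_density; under eq_fun do rewrite big_mkcond.
  apply: measurable_sum => j; case: (j < v)%N; last exact: measurable_cst.
  exact: measurable_sum.
rewrite (_ : [set _ | _] = (fun t => acc_density (x t) (y t) v) @^-1` `[gamma, +oo[).
  by rewrite -[X in measurable X]setTI; apply: macc => //; exact: measurable_itv.
by apply/seteqP; split=> t /=; rewrite in_itv /= andbT.
Qed.

Local Notation space := (@joint_space R L np nd lmax dD D).

Definition word (b : bool) (e : space) : blocks :=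
  fun j k => catv xp (phi (e (inl (b, (j, k)))).1).

Definition received (e : space) : blocks := fun j k i =>
  Complex (e (inr ((j, k), (false, None)))).2 (e (inr ((j, k), (true, None)))).2 *
    word false e j k i +
  Complex (e (inr ((j, k), (false, Some i)))).2 (e (inr ((j, k), (true, Some i)))).2.

Definition cross_time (b : bool) (e : space) : nat :=
  hit lmax (fun v => crosses (word b e) (received e) (inord v)).

Lemma measurable_cross_time (h : nat -> nat -> R) :
  measurable_fun setT (fun e => h (cross_time false e) (cross_time true e)).
Proof.
have m1 i : measurable_fun setT (fun e : space => (e i).1).
  exact: (measurableT_comp measurable_fst (measurable_coord i)).
have m2 i : measurable_fun setT (fun e : space => (e i).2).
  exact: (measurableT_comp measurable_snd (measurable_coord i)).
have mword b j k i : cmeasurable (fun e => word b e j k i).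
  by apply: cmeasurable_catv => //; exact: m1.
have mC a b : cmeasurable (fun e : space => Complex (e a).2 (e b).2).
  by split; exact: m2.
apply: (@measurable_fun_bool_table _ _ _ _ _
  (fun e (bv : bool * 'I_lmax.+1) => crosses (word bv.1 e) (received e) bv.2)
  (fun t => h (hit lmax (fun v => t (false, inord v)))
                   (hit lmax (fun v => t (true, inord v))))).
move=> [b v] /=; apply: measurable_crosses => // j k i.
by apply: cmeasurableD; [apply: cmeasurableM; [exact: mC|exact: mword]|exact: mC].
Qed.

Context {dO : measure_display} {Omega : measurableType dO}
  (P : probability Omega R).
Context (Xd Xbd : nat -> 'I_L -> Omega -> D) (Hr Hi : nat -> 'I_L -> Omega -> R)
  (Wr Wi : nat -> 'I_L -> 'I_(np + nd) -> Omega -> R).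

Local Notation model_point := (model_point (lmax := lmax) Xd Xbd Hr Hi Wr Wi).
Local Notation code_point := (code_point (lmax := lmax) Xd Xbd Hr Hi Wr Wi).

(** Only rounds [v <= lmax] matter to [hit]; there [inord] keeps [v], and the sum over ['I_v] widens
    to the guarded sum over ['I_lmax]. *)
Lemma cross_time_model_point w :
  hit lmax (fun v => gamma <= acc_dens rho xp PD phi Xd Hr Hi Wr Wi s v w) =
  cross_time false (model_point w).
Proof.
apply: eq_hit => v /andP[_ vle]; rewrite /crosses inordK ?ltnS //.
congr (_ <= _); exact: (big_ord_widen _ (fun j => \sum_(k < L) info_dens rho s xp PD phi
  (Xin xp phi Xd j k w) (Yin xp phi Xd Hr Hi Wr Wi j k w)) vle).
Qed.

Lemma cross_time_bar_model_point w :
  hit lmax (fun v => gamma <= acc_dens_bar rho xp PD phi Xd Xbd Hr Hi Wr Wi s v w) =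
  cross_time true (model_point w).
Proof.
apply: eq_hit => v /andP[_ vle]; rewrite /crosses inordK ?ltnS //.
congr (_ <= _); exact: (big_ord_widen _ (fun j => \sum_(k < L) info_dens rho s xp PD phi
  (Xbin xp phi Xbd j k w) (Yin xp phi Xd Hr Hi Wr Wi j k w)) vle).
Qed.

#[local] Opaque acc_density.

Variables (m0 : 'I_M) (p : R) (cb : bool -> Omega).

(** The sample point [cb u] fixes the codebook for [U = u]; rounds are allotted to messages as in
    [code_word_var]. *)
Definition codeword (u : bool) (m : 'I_M) : blocks :=
  fun j k => catv xp (phi (Xd (m * lmax + j)%N k (cb u))).

Definition test (u : bool) (y : blocks) (m : 'I_M) (v : nat) : bool :=
  crosses (codeword u m) y (inord v).

Definition threshold_code : @vlsf_code R L np nd M lmax := {|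
  pU := p;
  enc := codeword;
  dec := fun u v y => decision (test u y) m0 v;
  tstop := fun u y => stop_time lmax (test u y) |}.

Local Notation sent_output := (Ycode Hr Hi Wr Wi threshold_code).

Hypothesis lmax0 : (0 < lmax)%N.
Hypothesis mH : forall j k, measurable_fun setT (Hr j k) /\ measurable_fun setT (Hi j k).
Hypothesis mW : forall j k i, measurable_fun setT (Wr j k i) /\ measurable_fun setT (Wi j k i).

Lemma measurable_test (u : bool) (m m' : 'I_M) (v : 'I_lmax.+1) :
  measurable [set w | crosses (codeword u m') (sent_output u m w) v].
Proof.
apply: measurable_crosses => j k i; first exact: cmeasurable_cst.
apply: cmeasurableD.
  by apply: cmeasurableM; [have [] := mH j k; split|exact: cmeasurable_cst].
by have [] := mW j k i; split.
Qed.

Lemma test_causal u v y y' m v' :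
  (forall j : 'I_lmax, (j < v)%N -> y j = y' j) -> (v' <= v)%N ->
  test u y m v' = test u y' m v'.
Proof.
move=> eq_y le_v; apply: crosses_causal => j jv'.
by rewrite eq_y // (leq_trans jv').
Qed.

Lemma threshold_code_is_vlsf :
  0 <= p <= 1 -> vnorm2 xp = np%:R * rho ->
  (forall u j k, vnorm2 (phi (Xd j k (cb u))) = nd%:R * rho) ->
  is_vlsf_code rho Hr Hi Wr Wi threshold_code.
Proof.
move=> p01 xp_norm phi_norm; split; first exact: p01.
  move=> u m j k; rewrite /vnorm2 big_split_ord /=.
  transitivity (vnorm2 xp + vnorm2 (phi (Xd (m * lmax + j)%N k (cb u)))).
    congr (_ + _); apply: eq_bigr => i _; rewrite /codeword /catv.
      by rewrite (unsplitK (inl i)).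
    by rewrite (unsplitK (inr i)).
  by rewrite xp_norm phi_norm -mulrDl natrD.
split.
- move=> u v y y' eq_y.
  have E m : test u y m v = test u y' m v.
    exact: (@test_causal u v y y' m v eq_y (leqnn v)).
  exact: (congr1 (odflt m0) (eq_pick E)).
- by move=> u y; exact: stop_time_range.
- move=> u v y y' eq_y.
  (* Stopping by [v] is decided by the tests in rounds up to [v]; the first disjunct is the forced
     stop at [lmax]. *)
  have E (z : blocks) : (tstop threshold_code u z <= v)%N =
    (lmax.-1 < v)%N || has (fun v' => [exists m, test u z m v']) (iota 1 v).
    exact: hit_leE.
  refine (etrans (E y) (etrans (congr1 (orb _) _) (esym (E y')))).
  apply: eq_in_has => v'; rewrite mem_iota add1n ltnS => /andP[_ le_v].
  apply: eq_existsb => m; exact: (@test_causal u v y y' m v' eq_y le_v).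
- move=> u m v; split.
    apply: (@measurable_bool_table _ _ _
      (fun w (mv : 'I_M * 'I_lmax.+1) =>
              crosses (codeword u mv.1) (sent_output u m w) mv.2)
      (fun t => stop_time lmax (fun i v => t (i, inord v)) = v)).
    by move=> [m' v'] /=; exact: measurable_test.
  apply: (@measurable_bool_table _ _ _
    (fun w (mv : 'I_M * 'I_lmax.+1) =>
            crosses (codeword u mv.1) (sent_output u m w) mv.2)
    (fun t => let f := fun i v => t (i, inord v) in
                   decision f m0 (stop_time lmax f) != m)).
  by move=> [m' v'] /=; exact: measurable_test.
Qed.

Lemma measurable_stop_time (u : bool) (m : 'I_M) :
  measurable_fun setT
    (fun w => (tstop threshold_code u (sent_output u m w))%:R : R).
Proof.
apply: (@measurable_fun_bool_table _ _ _ _ _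
  (fun w (mv : 'I_M * 'I_lmax.+1) =>
          crosses (codeword u mv.1) (sent_output u m w) mv.2)
  (fun t => (stop_time lmax (fun i v => t (i, inord v)))%:R : R)).
by move=> [m' v'] /=; exact: measurable_test.
Qed.

(** For every competitor index [m'], the transmitted word of the code point is codeword [m], so its
    crossing time is that of the test of [m]. *)
Lemma tstop_le (u : bool) (m : 'I_M) (m' : nat) w :
  (tstop threshold_code u (sent_output u m w) <=
   minn lmax (cross_time false (code_point m m' (cb u, w))))%N.
Proof. exact: (stop_time_le (test u (sent_output u m w)) lmax0 m). Qed.

(** A pointwise union bound from [decision_error]. In the late term [m.+1] is a placeholder: that
    event ignores the competitor, and the law of the code point is known only for distinct
    indices. *)
Lemma dec_error_le (u : bool) (m : 'I_M) w :
  (dec threshold_code u (tstop threshold_code u (sent_output u m w))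
     (sent_output u m w) != m)%:R <=
  (lmax < cross_time false (code_point m m.+1 (cb u, w)))%N%:R +
  \sum_(m' < M | m' != m)
     (cross_time true (code_point m m' (cb u, w)) <=
      minn lmax (cross_time false (code_point m m' (cb u, w))))%N%:R :> R.
Proof.
case: (boolP (_ != m)) => [err|_]; last by rewrite addr_ge0 // sumr_ge0.
have [late|[m' m'm early]] := decision_error lmax0 err.
  by rewrite late lerDl sumr_ge0.
apply: (@le_trans _ _ ((cross_time true (code_point m m' (cb u, w)) <=
    minn lmax (cross_time false (code_point m m' (cb u, w))))%N%:R)).
  by rewrite early.
by rewrite (bigD1 m') //= addrCA lerDl addr_ge0 // sumr_ge0.
Qed.

End ThresholdCode.

(** * Averaging over codebooks *)

Section MeanOverMessages.
Context {d : measure_display} {T : measurableType d} {R : realType}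
  (P : probability T R).

Lemma probability_bool (b : T -> bool) : measurable [set w | b w] ->
  P [set w | b w] = (\int[P]_w (b w)%:R%:E)%E.
Proof.
move=> mb; rewrite -[in LHS](setIT [set w | b w]) -integral_indic //.
apply: eq_integral => w _; rewrite indicE; congr ((_ : bool)%:R)%:E.
by apply/idP/idP; rewrite inE.
Qed.

Lemma measurable_bool_set (b : T -> bool) :
  measurable_fun setT (fun w => (b w)%:R : R) -> measurable [set w | b w].
Proof.
move=> mb; rewrite (_ : [set _ | _] = (fun w => (b w)%:R : R) @^-1` [set 1]).
  by rewrite -[X in measurable X]setTI; apply: mb => //; exact: measurable_set1.
apply/seteqP; split=> w /=; first by move=> ->.
by case: (b w) => // /esym/eqP; rewrite oner_eq0.
Qed.

Lemma integral_message_mean (M : nat) (G : 'I_M -> T -> R) (c : R) :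
  (0 < M)%N ->
  (forall m, P.-integrable setT (EFin \o G m)) ->
  (forall m, (\int[P]_w (G m w)%:E = c%:E)%E) ->
  P.-integrable setT (EFin \o (fun w => M%:R^-1 * \sum_(m < M) G m w)) /\
  (\int[P]_w (M%:R^-1 * \sum_(m < M) G m w)%:E = c%:E)%E.
Proof.
move=> M0 iG intG.
have E : EFin \o (fun w => M%:R^-1 * \sum_(m < M) G m w) =
    (fun w => ((M%:R^-1)%:E * \sum_(m < M) (G m w)%:E)%E).
  by apply/funext => w /=; rewrite sumEFin EFinM.
have iS : P.-integrable setT (fun w => (\sum_(m < M) (G m w)%:E)%E).
  by apply: integrable_sum => // m _; exact: iG.
split; first by rewrite E; exact: integrableZl.
transitivity (\int[P]_w ((M%:R^-1)%:E * \sum_(m < M) (G m w)%:E))%E.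
  by apply: eq_integral => w _; rewrite sumEFin EFinM.
rewrite integralZl // integral_sum //.
under eq_bigr do rewrite intG.
rewrite sumEFin -EFinM sumr_const card_ord -[c *+ _]mulr_natl mulrA mulVf ?mul1r //.
by rewrite pnatr_eq0 -lt0n.
Qed.

End MeanOverMessages.

(** * Length and error of the threshold code for a fixed codebook *)

Section RandomCoding.
Context {R : realType} (gamma s rho : R) (lmax M L np nd : nat)
  (xp : 'I_np -> R[i]).
Context {dD : measure_display} {D : measurableType dD} (PD : probability D R)
  (phi : D -> 'I_nd -> R[i]).
Hypothesis mphi : forall b,
  measurable_fun setT (fun dd => complex.Re (phi dd b)) /\
  measurable_fun setT (fun dd => complex.Im (phi dd b)).
Context {dO : measure_display} {Omega : measurableType dO}
  (P : probability Omega R).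
Context (Xd Xbd : nat -> 'I_L -> Omega -> D) (Hr Hi : nat -> 'I_L -> Omega -> R)
  (Wr Wi : nat -> 'I_L -> 'I_(np + nd) -> Omega -> R).
Hypothesis lmax0 : (0 < lmax)%N.
Hypothesis mX : forall j k, measurable_fun setT (Xd j k) /\ measurable_fun setT (Xbd j k).
Hypothesis mH : forall j k, measurable_fun setT (Hr j k) /\ measurable_fun setT (Hi j k).
Hypothesis mW : forall j k i, measurable_fun setT (Wr j k i) /\ measurable_fun setT (Wi j k i).

Local Notation space := (@joint_space R L np nd lmax dD D).
Local Notation crossT := (cross_time gamma s rho xp PD phi).

Definition length_at (e : space) : R := (minn lmax (crossT false e))%:R.
Definition late_at (e : space) : R := (lmax < crossT false e)%N%:R.
Definition early_at (e : space) : R :=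
  (crossT true e <= minn lmax (crossT false e))%N%:R.

Lemma length_at_range e : 0 <= length_at e <= lmax%:R.
Proof. by rewrite ler0n ler_nat geq_minl. Qed.

Lemma late_at_range e : 0 <= late_at e <= 1.
Proof. by rewrite ler0n lern1 leq_b1. Qed.

Lemma early_at_range e : 0 <= early_at e <= 1.
Proof. by rewrite ler0n lern1 leq_b1. Qed.

Lemma measurable_length_at : measurable_fun setT length_at.
Proof.
exact: (measurable_cross_time gamma s rho xp PD mphi (fun t _ => (minn lmax t)%:R)).
Qed.

Lemma measurable_late_at : measurable_fun setT late_at.
Proof. exact: (measurable_cross_time gamma s rho xp PD mphi (fun t _ => (lmax < t)%N%:R)). Qed.

Lemma measurable_early_at : measurable_fun setT early_at.
Proof.
exact: (measurable_cross_time gamma s rho xp PD mphi (fun t t' => (t' <= minn lmax t)%N%:R)).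
Qed.

Local Notation mean_at F := (codebook_mean P Xd Xbd Hr Hi Wr Wi F).

Variables (m0 : 'I_M) (p : R) (cb : bool -> Omega).
Local Notation code := (threshold_code gamma s rho lmax xp PD phi Xd m0 p cb).
Local Notation sent_output := (Ycode Hr Hi Wr Wi code).

Lemma message_length_le (u : bool) (m : 'I_M) :
  (\int[P]_w (tstop code u (sent_output u m w))%:R%:E <=
   (mean_at length_at m m.+1 (cb u))%:E)%E.
Proof.
rewrite (codebook_meanE P mX mH mW measurable_length_at length_at_range).
apply: ge0_le_integral.
- exact: measurableT.
- by move=> w _; rewrite lee_fin ler0n.
- apply/measurable_EFinP.
  exact: (measurable_stop_time gamma s rho lmax xp PD mphi Xd m0 p cb mH mW u m).
- apply/measurable_EFinP.
  exact: (measurable_code_slice mX mH mW measurable_length_at).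
- move=> w _; rewrite lee_fin ler_nat.
  exact: (tstop_le gamma s rho xp PD phi Xd Xbd Hr Hi Wr Wi m0 p cb lmax0).
Qed.

Lemma message_error_le (u : bool) (m : 'I_M) :
  measurable [set w | dec code u (tstop code u (sent_output u m w))
                        (sent_output u m w) != m] ->
  (P [set w | dec code u (tstop code u (sent_output u m w))
                (sent_output u m w) != m] <=
   (mean_at late_at m m.+1 (cb u) +
    \sum_(m' < M | m' != m) mean_at early_at m m' (cb u))%:E)%E.
Proof.
move=> merr; rewrite (probability_bool P merr) EFinD -sumEFin.
rewrite (codebook_meanE P mX mH mW measurable_late_at late_at_range).
under eq_bigr do
  rewrite (codebook_meanE P mX mH mW measurable_early_at early_at_range).
have iL := integrable_code_slice P mX mH mW measurable_late_at late_at_range m m.+1 (cb u).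
have iE m' := integrable_code_slice P mX mH mW measurable_early_at early_at_range m m' (cb u).
rewrite -integral_sum // -integralD //; last by apply: integrable_sum => // m' _; exact: iE.
apply: ge0_le_integral.
- exact: measurableT.
- by move=> w _; rewrite lee_fin ler0n.
- apply/measurable_EFinP.
  (* A table with a single entry turns the measurable event into a measurable indicator. *)
  apply: (@measurable_fun_bool_table _ _ unit _ _
    (fun w _ => dec code u (tstop code u (sent_output u m w)) (sent_output u m w) != m)
    (fun t => (t tt)%:R : R)).
  by move=> _; exact: merr.
- have iS : P.-integrable setT (fun w => (\sum_(m' < M | m' != m)
      (early_at (code_point Xd Xbd Hr Hi Wr Wi m m' (cb u, w)))%:E)%E).
    by apply: integrable_sum => // m' _; exact: iE.
  by have /integrableP[] := integrableD measurableT iL iS.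
- move=> w _; rewrite sumEFin -EFinD lee_fin.
  exact: (dec_error_le gamma s rho xp PD phi Xd Xbd Hr Hi Wr Wi m0 p cb lmax0).
Qed.

End RandomCoding.

(** Null sets pull back to null sets; this carries the power constraint from [PD] to each data
    block. *)
Lemma ae_preimage {d d' : measure_display} {T : measurableType d}
    {U : measurableType d'} {R : realType} (P : {measure set T -> \bar R})
    (Q : {measure set U -> \bar R}) (X : T -> U) (A : U -> Prop) :
  measurable_fun setT X ->
  (forall B, measurable B -> P (X @^-1` B) = Q B) ->
  {ae Q, forall x, A x} -> {ae P, forall w, A (X w)}.
Proof.
move=> mX law [N [mN QN0 sub]]; exists (X @^-1` N); split.
- by rewrite -[X in measurable X]setTI; exact: mX.
- by rewrite law.
- by move=> w; exact: sub.
Qed.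

(** * Mean bounds and the choice of two codebooks *)

Theorem theorem2 (R : realType) (gamma s rho : R) (lmax M L np nd : nat)
  (xp : 'I_np -> R[i])
  (dD : measure_display) (D : measurableType dD) (PD : probability D R)
  (phi : D -> 'I_nd -> R[i])
  (dO : measure_display) (Omega : measurableType dO) (P : probability Omega R)
  (Xd Xbd : nat -> 'I_L -> Omega -> D)
  (Hr Hi : nat -> 'I_L -> Omega -> R)
  (Wr Wi : nat -> 'I_L -> 'I_(np + nd) -> Omega -> R) :
  0 < gamma -> 0 <= s -> 0 < rho ->
  (0 < lmax)%N -> (0 < M)%N -> (0 < L)%N -> (1 <= np)%N -> (1 <= nd)%N ->
  vnorm2 xp = np%:R * rho ->
  (* P_{X^(d)} = phi # PD is a distribution on C^{nd} with [x^(p), X^(d)] in X a.s. *)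
  (forall b, measurable_fun setT (fun dd => complex.Re (phi dd b)) /\
             measurable_fun setT (fun dd => complex.Im (phi dd b))) ->
  {ae PD, forall dd, vnorm2 (phi dd) = nd%:R * rho} ->
  model_assumptions PD P Xd Xbd Hr Hi Wr Wi ->
  let tau w := hit lmax (fun v => gamma <= acc_dens rho xp PD phi Xd Hr Hi Wr Wi s v w) in
  let taubar w := hit lmax (fun v => gamma <= acc_dens_bar rho xp PD phi Xd Xbd Hr Hi Wr Wi s v w) in
  exists c : @vlsf_code R L np nd M lmax,
    is_vlsf_code rho Hr Hi Wr Wi c /\
    (code_len P Hr Hi Wr Wi c <= \int[P]_w ((minn lmax (tau w))%:R)%:E)%E /\
    (code_err P Hr Hi Wr Wi c <=
       (M%:R - 1)%:E * P [set w | (taubar w <= minn lmax (tau w))%N]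
       + P [set w | (lmax < tau w)%N])%E.
Proof.
move=> _ _ _ lmax0 M0 _ _ _ xp_norm mphi phi_norm.
move=> [mX mH mW [lawX _ _ indep]] tau taubar.
pose ct := @cross_time R gamma s rho lmax L np nd xp dD D PD phi.
pose mp := @model_point R L np nd lmax dD D dO Omega Xd Xbd Hr Hi Wr Wi.
have tauE w : tau w = ct false (mp w) by exact: cross_time_model_point.
have taubarE w : taubar w = ct true (mp w) by exact: cross_time_bar_model_point.
pose Flen := @length_at R gamma s rho lmax L np nd xp dD D PD phi.
pose Flate := @late_at R gamma s rho lmax L np nd xp dD D PD phi.
pose Fearly := @early_at R gamma s rho lmax L np nd xp dD D PD phi.
have mlen : measurable_fun setT Flen by exact: measurable_length_at.
have mlate : measurable_fun setT Flate by exact: measurable_late_at.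
have mearly : measurable_fun setT Fearly by exact: measurable_early_at.
have rlen e : 0 <= Flen e <= lmax%:R by exact: length_at_range.
have rlate e : 0 <= Flate e <= 1 by exact: late_at_range.
have rearly e : 0 <= Fearly e <= 1 by exact: early_at_range.
pose mean F := @codebook_mean R L np nd lmax dD D dO Omega P Xd Xbd Hr Hi Wr Wi F.
have integ (F : @joint_space R L np nd lmax dD D -> R) (C : R)
    (mF : measurable_fun setT F) (rF : forall e, 0 <= F e <= C) m m' :
    P.-integrable setT (EFin \o mean F m m').
  exact: (integrable_codebook_mean P mX mH mW mF rF).
have int_mean (F : @joint_space R L np nd lmax dD D -> R) (C : R)
    (mF : measurable_fun setT F) (rF : forall e, 0 <= F e <= C) m m' :
    m != m' -> (\int[P]_w' (mean F m m' w')%:E = \int[P]_w (F (mp w))%:E)%E.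
  exact: (integral_codebook_mean mX mH mW lawX indep mF rF).
have model_fin (F : @joint_space R L np nd lmax dD D -> R) (C : R)
    (mF : measurable_fun setT F) (rF : forall e, 0 <= F e <= C) :
    (\int[P]_w (F (mp w))%:E \is a fin_num)%E.
  rewrite -(int_mean F C mF rF 0%N 1%N) //.
  exact: (integrable_fin_num measurableT (integ F C mF rF 0%N 1%N)).
(* Real versions of the three quantities in the bounds, so that the two-point lemma applies. *)
pose alen := fine (\int[P]_w (Flen (mp w))%:E)%E.
pose alate := fine (\int[P]_w (Flate (mp w))%:E)%E.
pose aearly := fine (\int[P]_w (Fearly (mp w))%:E)%E.
have alenE : alen%:E = (\int[P]_w (Flen (mp w))%:E)%E.
  by rewrite fineK // (model_fin _ _ mlen rlen).
have alateE : alate%:E = (\int[P]_w (Flate (mp w))%:E)%E.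
  by rewrite fineK // (model_fin _ _ mlate rlate).
have aearlyE : aearly%:E = (\int[P]_w (Fearly (mp w))%:E)%E.
  by rewrite fineK // (model_fin _ _ mearly rearly).
pose len_of (m : 'I_M) (w : Omega) : R := mean Flen m m.+1 w.
pose err_of (m : 'I_M) (w : Omega) : R :=
  mean Flate m m.+1 w + \sum_(m' < M | m' != m) mean Fearly m m' w.
have neqS (m : nat) : m != m.+1 by rewrite neq_ltn ltnSn.
have neqV (m m' : 'I_M) : m' != m -> m != m' :> nat by rewrite eq_sym.
have [ilen Elen] := integral_message_mean (G := len_of) M0
  (fun m => integ _ _ mlen rlen m m.+1)
  (fun m => etrans (int_mean _ _ mlen rlen m m.+1 (neqS m)) (esym alenE)).
have isum (m : 'I_M) : P.-integrable setT
    (fun w => (\sum_(m' < M | m' != m) (mean Fearly m m' w)%:E)%E).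
  by apply: integrable_sum => // m' _; exact: (integ _ _ mearly rearly).
have ierr m : P.-integrable setT (EFin \o err_of m).
  rewrite (_ : EFin \o _ = (EFin \o mean Flate m m.+1) \+
      (fun w => (\sum_(m' < M | m' != m) (mean Fearly m m' w)%:E)%E))%E.
    by apply: integrableD => //; exact: (integ _ _ mlate rlate).
  by apply/funext => w; rewrite /= sumEFin.
(* Each of the [M - 1] competitors contributes the same mean [aearly]. *)
have interr m : (\int[P]_w (err_of m w)%:E = (alate + (M%:R - 1) * aearly)%:E)%E.
  transitivity (\int[P]_w ((mean Flate m m.+1 w)%:E +
      \sum_(m' < M | m' != m) (mean Fearly m m' w)%:E))%E.
    by apply: eq_integral => w _; rewrite sumEFin.
  rewrite integralD //; last exact: (integ _ _ mlate rlate).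
  rewrite (int_mean _ _ mlate rlate) // -alateE EFinD; congr (_ + _)%E.
  rewrite integral_sum //; last by move=> m'; exact: (integ _ _ mearly rearly).
  transitivity (\sum_(m' < M | m' != m) aearly%:E)%E.
    apply: eq_bigr => m' m'm.
    exact: (etrans (int_mean _ _ mearly rearly m m' (neqV _ _ m'm)) (esym aearlyE)).
  rewrite sumEFin sumr_const -[aearly *+ _]mulr_natl; congr (_ * _)%:E.
  by rewrite cardC1 card_ord -subn1 natrB.
have [ierrM EerrM] := integral_message_mean (G := err_of) M0 ierr interr.
(* The chosen sample points must satisfy the power constraint in all blocks simultaneously;
   countably many almost sure events allow this. *)
pose good w := forall (j : nat) (k : 'I_L), vnorm2 (phi (Xd j k w)) = nd%:R * rho.
have ae_good : {ae P, forall w, good w}.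
  apply: ae_foralln => j; apply: filter_forall => k.
  apply: (ae_preimage (mX j k).1 _ phi_norm) => B mB.
  exact: (lawX j k B mB).1.
have le_eq (x y : \bar R) : x = y -> (x <= y)%E by move=> ->.
have [w1 [w2 [p [good1 good2 p01 le_len le_err]]]] := two_point_below_mean
  ilen ierrM (le_eq _ _ Elen) (le_eq _ _ EerrM) ae_good.
(* The codebook drawn at [w1] is used when [U = true], which has probability [p]. *)
pose cb (u : bool) := if u then w1 else w2.
pose m0 : 'I_M := Ordinal M0.
pose c := threshold_code gamma s rho lmax xp PD phi Xd m0 p cb.
have is_code : is_vlsf_code rho Hr Hi Wr Wi c.
  apply: threshold_code_is_vlsf => //.
  by move=> [] j k; [exact: good1|exact: good2].
have lenE : (\int[P]_w (minn lmax (tau w))%:R%:E = alen%:E)%E.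
  by rewrite alenE; apply: eq_integral => w _; rewrite tauE.
have lateE : P [set w | (lmax < tau w)%N] = alate%:E.
  rewrite alateE probability_bool.
    by apply: eq_integral => w _; rewrite tauE.
  apply: measurable_bool_set; under eq_fun do rewrite tauE.
  exact: (measurableT_comp mlate (measurable_model_point mX mH mW)).
have earlyE : P [set w | (taubar w <= minn lmax (tau w))%N] = aearly%:E.
  rewrite aearlyE probability_bool.
    by apply: eq_integral => w _; rewrite tauE taubarE.
  apply: measurable_bool_set; under eq_fun do rewrite tauE taubarE.
  exact: (measurableT_comp mearly (measurable_model_point mX mH mW)).
have wU_ge0 u : 0 <= wU c u.
  by have /andP[p0 p1] := p01; case: u => /=; rewrite ?subr_ge0.
have average_le (X : bool -> 'I_M -> \bar R) (Y : 'I_M -> Omega -> R) (B : R) :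
    (forall u m, (X u m <= (Y m (cb u))%:E)%E) ->
    p * (M%:R^-1 * \sum_(m < M) Y m w1) + (1 - p) * (M%:R^-1 * \sum_(m < M) Y m w2) <= B ->
    (\sum_(u : bool) (wU c u)%:E * (M%:R^-1)%:E * \sum_(m < M) X u m <= B%:E)%E.
  move=> XY YB.
  apply: (@le_trans _ _ (\sum_(u : bool)
      (wU c u * (M%:R^-1 * \sum_(m < M) Y m (cb u)))%:E)%E).
    apply: lee_sum => u _; rewrite -muleA EFinM lee_wpmul2l ?lee_fin //.
    rewrite EFinM lee_wpmul2l ?lee_fin ?invr_ge0 // -sumEFin.
    by apply: lee_sum => m _; exact: XY.
  by rewrite big_bool /= -EFinD lee_fin.
exists c; split; first exact: is_code.
have [_ _ [_ _ _ mcode]] := is_code.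
split.
  rewrite lenE; apply: (average_le _ len_of) => [u m|]; last exact: le_len.
  exact: (message_length_le gamma s rho xp PD mphi P lmax0 mX mH mW).
rewrite earlyE lateE -EFinM -EFinD addrC.
apply: (average_le _ err_of) => [u m|]; last exact: le_err.
apply: message_error_le => //.
(* The error event does not involve the round, so any value such as 0 serves. *)
exact: (mcode u m 0%N).2.
Qed.
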